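(* Let $\lambda_n=-in(n^4+n^2-1)$ for $n\in\mathbb{Z}$. There exist positive constants $T>2\pi$, $b$ and $C$ and a sequence $(\zeta_m)_{m\in\mathbb{Z}}$ biorthogonal to the family $(e^{-\lambda_mt})_{m\in\mathbb{Z}}$ in $L^2(-\frac T2,\frac T2)$ with the property that $$\int_{-\frac T2}^{\frac T2}\left|\sum_{m\in\mathbb{Z}^*}c_m\zeta_m(t)\right|^2dt\le C\sum_{m\in\mathbb{Z}^*}|c_m|^2e^{2bm^6}$$ for any sequence $(c_m)_{m\in\mathbb{Z}^*}$ of complex numbers.
   Context: $\mathbb{Z}^*=\mathbb{Z}\setminus\{0\}$. The numbers $\lambda_n$ are the eigenvalues of $Au=\partial_x^5u-\partial_x^3u-\partial_xu$ with periodic boundary conditions on $(0,2\pi)$. A sequence $(\zeta_m)$ in $L^2(I)$ (complex-valued functions) is biorthogonal to a family $(e_n)\subset L^2(I)$ with the same index set if $\int_I\zeta_m(t)\overline{e_n(t)}\,dt=\delta_{mn}$ (Kronecker symbol) for all $m,n$; for $e_n(t)=e^{-\lambda_nt}$ this reads $\int_I\zeta_m(t)e^{\lambda_nt}\,dt=\delta_{mn}$. If the right-hand side of the inequality is infinite there is nothing to assert; if it is finite, the series on the left is understood to converge in $L^2(-\frac T2,\frac T2)$. *)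

(* Defs.v *)
From HB Require Import structures.
From mathcomp Require Export all_boot all_order all_algebra finmap complex.
From mathcomp Require Export all_classical all_reals all_analysis.
Export Order.TTheory GRing.Theory Num.Theory.
Export numFieldNormedType.Exports.

Set Implicit Arguments.
Unset Strict Implicit.
Unset Printing Implicit Defensive.

Local Open Scope classical_set_scope.
Local Open Scope ring_scope.
Local Open Scope complex_scope.

Definition cexp (R : realType) (z : R[i]) : R[i] :=
  (expR (complex.Re z))%:C * (cos (complex.Im z) +i* sin (complex.Im z)).

Definition lambda (R : realType) (n : int) : R[i] :=
  - 'i%C * n%:~R * (n%:~R ^+ 4 + n%:~R ^+ 2 - 1).

Definition Zstar : set int := [set n | n != 0].

Definition cintegral (R : realType) (D : set R) (f : R -> R[i]) : R[i] :=
  Rintegral lebesgue_measure D (fun t => complex.Re (f t)) +i*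
  Rintegral lebesgue_measure D (fun t => complex.Im (f t)).

Definition L2sqnorm (R : realType) (D : set R) (f : R -> R[i]) : \bar R :=
  (\int[lebesgue_measure]_(t in D) (ComplexField.Normc.normc (f t) ^+ 2)%:E)%E.

Definition inL2 (R : realType) (D : set R) (f : R -> R[i]) : Prop :=
  [/\ measurable_fun D (fun t => complex.Re (f t)),
      measurable_fun D (fun t => complex.Im (f t)) &
      (L2sqnorm D f < +oo)%E].

Definition biorthogonal (R : realType) (I : eqType) (D : set R)
    (zeta e : I -> R -> R[i]) : Prop :=
  [/\ forall m, inL2 D (zeta m),
      forall n, inL2 D (e n) &
      forall m n, cintegral D (fun t => zeta m t * conjc (e n t)) = (m == n)%:R].

(* Unconditional convergence of sum_(i in S) f i to g in L^2(D): convergence of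
   the net of the partial sums over the finite subsets of S. *)
Definition L2_has_sum (R : realType) (I : choiceType) (D : set R) (S : set I)
    (f : I -> R -> R[i]) (g : R -> R[i]) : Prop :=
  inL2 D g /\
  forall eps : R, 0 < eps ->
    exists2 F0 : {fset I}, [set` F0] `<=` S &
      forall F : {fset I}, [set` F0] `<=` [set` F] -> [set` F] `<=` S ->
        (L2sqnorm D (fun t => (\sum_(i <- F) f i t) - g t)%R < eps%:E)%E.

(* Main.v *)
Require Import Defs.
From mathcomp Require Import zify ring lra.
From mathcomp Require Import measurable_realfun.

Set Implicit Arguments.
Unset Strict Implicit.
Unset Printing Implicit Defensive.

Local Open Scope classical_set_scope.
Local Open Scope ring_scope.
Local Open Scope complex_scope.

(** The eigenvalues are [- i k_n] where the frequencies [k_n = n^5 + n^3 - n]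
    are pairwise distinct integers ([freq_inj]).  Hence the functions
    [e^{- lambda_n t} = e^{i k_n t}] all have period [2 pi], and on an interval
    covering exactly two periods they are orthogonal with squared norm [4 pi]
    ([cintegral_cexp_int]).  So for [T = 4 pi] the family divided by [4 pi] is
    biorthogonal to the family itself.

    For the inequality take [b = 1] and let [A] be the weighted sum
    [sum |c_m|^2 e^{2 m^6}].  If it is finite, each of its terms is at most [A],
    whence [|c_m| <= sqrt A e^{- m^6} <= sqrt A 2^{- |m|}]
    ([coeff_dyadic_bound]).  Since [|zeta_m| = 1 / (4 pi)], the series
    [sum c_m zeta_m] is dominated, uniformly in [t], by a geometric series.
    Its pointwise sum is therefore measurable and bounded, and both the
    convergence in [L^2] and the bound on the norm come from uniform estimates
    on a bounded interval ([L2_has_sum_dyadic]).  Summed over the nonzero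
    integers, the geometric series bounds the real and imaginary parts by
    [2 sqrt A / (4 pi)] each, and integrating the squares over an interval of
    length [4 pi] gives [C = 2 / pi]. *)

(** * Frequencies *)

Definition freq (n : int) : int := n ^+ 5 + n ^+ 3 - n.

(** If [freq m = freq n] with [m <> n], the cofactor
    [m^4 + m^3 n + m^2 n^2 + m n^3 + n^4 + m^2 + m n + n^2 - 1] vanishes, but
    it is positive as soon as one of the integers [m], [n] is nonzero. *)
Lemma freq_inj : injective freq.
Proof.
move=> m n /eqP; rewrite -subr_eq0 => /eqP h; apply/eqP; rewrite -subr_eq0.
(* Twice the cofactor of m - n is a sum of squares minus 2; these squares add
   up to at least 4 as soon as m or n is nonzero. *)
have f2 : 2 * (freq m - freq n) = (m - n) *
    ((m ^+ 2 + n ^+ 2) * (m + n) ^+ 2 + (m ^+ 2) ^+ 2 + (n ^+ 2) ^+ 2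
     + (m + n) ^+ 2 + m ^+ 2 + n ^+ 2 - 2) by rewrite /freq; ring.
move: f2; rewrite h mulr0 => /esym/eqP; rewrite mulf_eq0 => /orP[//|/eqP q].
have := sqr_ge0 (m + n); have := sqr_ge0 m; have := sqr_ge0 n.
have [->|n0] := eqVneq n 0; have [->|m0] := eqVneq m 0; first by rewrite subrr.
all: move: q; nia.
Qed.

Lemma cexp_lambda (R : realType) (n : int) (t : R) :
  cexp (- lambda R n * t%:C) =
  cos ((freq n)%:~R * t) +i* sin ((freq n)%:~R * t).
Proof.
have -> : - lambda R n * t%:C = 0 +i* ((freq n)%:~R * t).
  rewrite /lambda -(rmorph_int (real_complex R)) /freq.
  rewrite rmorphB rmorphD !rmorphXn /=.
  move: (n%:~R : R) => x.
  apply/eqP; rewrite eq_complex /=; apply/andP; split; apply/eqP.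
    ring.
  rewrite /=; ring.
by rewrite /cexp /= expR0 mul1r.
Qed.

(** * Orthogonality on two periods *)

Lemma integral_derivative_itvoo (R : realType) (f F : R -> R) (a b : R) :
  a < b -> continuous f -> (forall t : R, is_derive t 1 F (f t)) ->
  Rintegral lebesgue_measure `]a, b[%classic f = F b - F a.
Proof.
move=> ab cf dF.
have dF1 (t : R) : derivable F t 1 by [].
have cF : continuous F.
  by move=> t; apply: differentiable_continuous; apply/derivable1_diffP.
rewrite /Rintegral -(@integral_itv_bndoo _ a b _ true false); last first.
  apply/measurable_EFinP; apply: measurable_funTS.
  exact: continuous_measurable_fun.
rewrite (@continuous_FTC2 _ f F)//.
- exact: continuous_subspaceT.
- split => //.
  + by apply: cvg_at_right_filter; exact: cF.
  + by apply: cvg_at_left_filter; exact: cF.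
- by move=> t _; rewrite derive1E; exact: derive_val.
Qed.

Lemma is_derive_comp_scale (R : realType) (f f' : R -> R) (k t : R) :
  (forall u : R, is_derive u 1 f (f' u)) ->
  is_derive t 1 (fun u => f (k * u)) (k * f' (k * t)).
Proof.
move=> df; rewrite mulrC.
apply: (@is_derive1_comp _ f ( *%R k)).
by rewrite -[X in is_derive _ _ _ X](mulr1 k); exact: is_deriveZ.
Qed.

Lemma continuous_comp_scale (R : realType) (f : R -> R) (k : R) :
  continuous f -> continuous (fun t => f (k * t)).
Proof.
move=> cf t; apply: (@continuous_comp _ _ _ ( *%R k) f); last exact: cf.
exact: mulrl_continuous.
Qed.

Lemma sin_int2pi (R : realType) (k : int) : sin (k%:~R * (2 * pi)) = 0 :> R.
Proof.
have H (n : nat) : sin (n%:~R * (2 * pi)) = 0 :> R.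
  have := periodicn (@sinD2pi R) n 0; rewrite add0r sin0 => <-.
  by congr sin; rewrite -pmulrn !mulr_natl.
case: k => n; first exact: H.
by rewrite NegzE mulrNz mulNr sinN H oppr0.
Qed.

Lemma integral_cos_int (R : realType) (k : int) :
  Rintegral lebesgue_measure `]- (2 * pi), (2 * pi)[%classic
    (fun t : R => cos (k%:~R * t)) = if k == 0 then 4 * pi else 0.
Proof.
have pi0 := pi_gt0 R.
have ab : - (2 * pi) < 2 * pi :> R by lra.
have cc := continuous_comp_scale (k := k%:~R) (@continuous_cos R).
have [k0|k0] := eqVneq.
  have d (t : R) : is_derive t 1 id (cos (k%:~R * t)).
    by rewrite k0 mul0r cos0; exact: is_derive_id.
  by rewrite (integral_derivative_itvoo ab cc d); ring.
have kR : k%:~R != 0 :> R by rewrite intr_eq0.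
have d (t : R) : is_derive t 1 (fun t => k%:~R^-1 * sin (k%:~R * t))
    (cos (k%:~R * t)).
  rewrite -[X in is_derive _ _ _ X](mulKf kR).
  by apply: is_deriveZ; exact: is_derive_comp_scale.
by rewrite (integral_derivative_itvoo ab cc d) mulrN sinN sin_int2pi; ring.
Qed.

(** The primitive [- cos (k t) / k] is even, so its increment over a symmetric
    interval vanishes; for [k = 0] the same formula gives the constant 0 because
    the inverse of 0 is 0. *)
Lemma integral_sin_int (R : realType) (k : int) :
  Rintegral lebesgue_measure `]- (2 * pi), (2 * pi)[%classic
    (fun t : R => sin (k%:~R * t)) = 0.
Proof.
have pi0 := pi_gt0 R.
have ab : - (2 * pi) < 2 * pi :> R by lra.
have cs := continuous_comp_scale (k := k%:~R) (@continuous_sin R).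
have d (t : R) : is_derive t 1 (fun t => - k%:~R^-1 * cos (k%:~R * t))
    (sin (k%:~R * t)).
  have [->|k0] := eqVneq k 0.
    rewrite mul0r sin0; under eq_fun do rewrite mul0r; exact: is_derive_cst.
  have kR : k%:~R != 0 :> R by rewrite intr_eq0.
  have -> : sin (k%:~R * t) = - k%:~R^-1 * (k%:~R * - sin (k%:~R * t)) by field.
  by apply: is_deriveZ; exact: is_derive_comp_scale.
by rewrite (integral_derivative_itvoo ab cs d) mulrN cosN subrr.
Qed.

Lemma integrable_itvoo (R : realType) (f : R -> R) (a b : R) : continuous f ->
  lebesgue_measure.-integrable `]a, b[ (EFin \o f).
Proof.
move=> cf.
have cab : lebesgue_measure.-integrable `[a, b] (EFin \o f).
  apply: continuous_compact_integrable; first exact: segment_compact.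
  exact: continuous_subspaceT.
apply: integrableS cab => //.
by apply: subset_itv; rewrite bnd_simp.
Qed.

Lemma cos_sin_conj (R : realType) (k l t : R) :
 (cos (k * t) +i* sin (k * t)) * conjc (cos (l * t) +i* sin (l * t)) =
  cos ((k - l) * t) +i* sin ((k - l) * t).
Proof.
rewrite mulrBl cosB sinB; apply/eqP; rewrite eq_complex /=.
by apply/andP; split; apply/eqP; ring.
Qed.

Lemma cintegral_cexp_int (R : realType) (k : int) :
  cintegral `]- (2 * pi), (2 * pi)[ (fun t : R =>
    ((4 * pi)^-1)%:C * (cos (k%:~R * t) +i* sin (k%:~R * t))) = (k == 0)%:R.
Proof.
have cc := continuous_comp_scale (k := k%:~R) (@continuous_cos R).
have cs := continuous_comp_scale (k := k%:~R) (@continuous_sin R).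
rewrite /cintegral.
under eq_Rintegral do rewrite /= mul0r subr0.
under [X in _ +i* X]eq_Rintegral do rewrite /= mul0r addr0.
rewrite !RintegralZl //; try exact: integrable_itvoo.
rewrite integral_cos_int integral_sin_int mulr0.
case: ifP => _; last by rewrite mulr0.
by rewrite mulVf ?mulf_neq0// gt_eqF ?pi_gt0.
Qed.

(** * Bounded functions in L2 *)

Lemma sqr_normc (R : rcfType) (z : R[i]) :
  Normc.normc z ^+ 2 = complex.Re z ^+ 2 + complex.Im z ^+ 2.
Proof. by case: z => a b /=; rewrite sqr_sqrtr// addr_ge0 ?sqr_ge0. Qed.

Lemma Re_sum (R : rcfType) (I : Type) (s : seq I) (f : I -> R[i]) :
  complex.Re (\sum_(i <- s) f i) = \sum_(i <- s) complex.Re (f i).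
Proof. by apply: (big_morph (@complex.Re R)) => // -[? ?] [? ?]. Qed.

Lemma Im_sum (R : rcfType) (I : Type) (s : seq I) (f : I -> R[i]) :
  complex.Im (\sum_(i <- s) f i) = \sum_(i <- s) complex.Im (f i).
Proof. by apply: (big_morph (@complex.Im R)) => // -[? ?] [? ?]. Qed.

Lemma normr_Re_Im_le (R : rcfType) (z : R[i]) (M : R) : Normc.normc z <= M ->
  `|complex.Re z| <= M /\ `|complex.Im z| <= M.
Proof.
move=> zM; have M0 : 0 <= M.
  by apply: le_trans zM; case: z => a b; exact: sqrtr_ge0.
have : Normc.normc z ^+ 2 <= M ^+ 2.
  by rewrite lerXn2r ?nnegrE//; case: z zM => a b _; exact: sqrtr_ge0.
rewrite sqr_normc => h.
have := sqr_ge0 (complex.Re z); have := sqr_ge0 (complex.Im z) => i0 r0.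
by split; rewrite -(@ler_pXn2r _ 2) ?nnegrE// real_normK ?num_real//; lra.
Qed.

Lemma L2sqnorm_le_bounded (R : realType) (a b M : R) (f : R -> R[i]) : a < b ->
  measurable_fun `]a, b[ (fun t => complex.Re (f t)) ->
  measurable_fun `]a, b[ (fun t => complex.Im (f t)) ->
  (forall t, `|complex.Re (f t)| <= M) ->
  (forall t, `|complex.Im (f t)| <= M) ->
  (L2sqnorm `]a, b[ f <= (2 * M ^+ 2 * (b - a))%:E)%E.
Proof.
move=> ab mr mi rM iM; have M0 : 0 <= M := le_trans (normr_ge0 _) (rM 0).
have -> : (2 * M ^+ 2 * (b - a))%:E =
    (\int[lebesgue_measure]_(t in `]a, b[) cst (2 * M ^+ 2)%:E t)%E.
  by rewrite integral_cst//= lebesgue_measure_itv/= lte_fin ab -EFinD -EFinM.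
rewrite /L2sqnorm; under eq_integral do rewrite sqr_normc.
apply: ge0_le_integral => //.
- by move=> t _; rewrite lee_fin addr_ge0 ?sqr_ge0.
- by apply/measurable_EFinP; apply: measurable_funD; apply: measurable_funX.
- move=> t _; rewrite lee_fin mulr_natl mulr2n.
  by apply: lerD; rewrite -real_normK ?num_real// lerXn2r ?nnegrE.
Qed.

Lemma inL2_bounded (R : realType) (a b M : R) (f : R -> R[i]) : a < b ->
  measurable_fun `]a, b[ (fun t => complex.Re (f t)) ->
  measurable_fun `]a, b[ (fun t => complex.Im (f t)) ->
  (forall t, `|complex.Re (f t)| <= M) ->
  (forall t, `|complex.Im (f t)| <= M) -> inL2 `]a, b[ f.
Proof.
move=> ab mr mi rM iM; split => //.
exact: le_lt_trans (L2sqnorm_le_bounded ab mr mi rM iM) (ltry _).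
Qed.

(** * Dyadically dominated series over the nonzero integers *)

(** Enumerated as two halves so that sums over these balls are the partial sums
    of a series indexed by the natural numbers. *)
Definition nz_ball (N : nat) : seq int :=
  [seq Posz k.+1 | k <- iota 0 N] ++ [seq Negz k | k <- iota 0 N].

Lemma mem_nz_ball N m : (m \in nz_ball N) = (0 < `|m| <= N)%N.
Proof.
rewrite mem_cat; apply/orP/idP => [[]/mapP[k]|]; rewrite ?mem_iota; [lia|lia|].
case: m => [[|k]|k] h; first by [].
- by left; apply: map_f; rewrite mem_iota; lia.
- by right; apply: map_f; rewrite mem_iota; lia.
Qed.

Lemma nz_ball_uniq N : uniq (nz_ball N).
Proof.
rewrite cat_uniq !map_inj_uniq ?iota_uniq ?andbT/=; last 2 first.
- by move=> i j [].
- by move=> i j [].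
by apply/hasPn => _ /mapP[k _ ->]; apply/mapP => -[].
Qed.

Lemma sum_nz_ball (V : zmodType) (x : int -> V) :
  (fun N => \sum_(m <- nz_ball N) x m) = [series x (Posz k.+1) + x (Negz k)]_k.
Proof.
apply/funext => N; rewrite big_cat !big_map /series /= big_split /=.
by rewrite /index_iota subn0.
Qed.

(** Peel off the integers of smallest modulus [N + 1]: there are at most two of
    them, contributing at most half of the bound, and the tail beyond [N + 1]
    is bounded by the other half. *)
Lemma sum_half_pow_tail (R : realFieldType) (N : nat) (s : seq int) : uniq s ->
  all (fun m => N < `|m|)%N s ->
  \sum_(m <- s) 2^-1 ^+ `|m|%N <= 2 * 2^-1 ^+ N :> R.
Proof.
pose M := \max_(m <- s) `|m|%N.
have /allP sM : all (fun m => `|m| <= N + M)%N s.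
  apply/allP => m ms; apply: leq_trans (leq_addl _ _).
  by apply: leq_bigmax_seq.
move: M sM => M; elim: M N s => [|M IH] N s sM us /allP sN.
  have -> : s = [::].
    case: s sM sN {us} => // m s sM sN.
    by have := sN m (mem_head m s); rewrite ltnNge -[N]addn0 sM// mem_head.
  by rewrite big_nil mulr_ge0 ?exprn_ge0 ?invr_ge0.
rewrite (bigID (fun m : int => `|m|%N == N.+1)) /=.
have -> : 2 * 2^-1 ^+ N = 2 * 2^-1 ^+ N.+1 + 2 * 2^-1 ^+ N.+1 :> R.
  by rewrite exprS; field.
apply: lerD.
  rewrite (eq_bigr (fun=> 2^-1 ^+ N.+1)); last by move=> m /eqP ->.
  rewrite big_const_seq iter_addr_0 mulr_natl; apply: ler_wpMn2l.
    by rewrite exprn_ge0 ?invr_ge0.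
  rewrite -size_filter; apply: (@uniq_leq_size _ _ [:: Posz N.+1; - Posz N.+1]).
    exact: filter_uniq.
  by move=> m; rewrite mem_filter !inE => /andP[/eqP <- _]; lia.
rewrite -big_filter; apply: IH; last 2 first.
- exact: filter_uniq.
- by apply/allP => m; rewrite mem_filter => /andP[h /sN]; lia.
- by move=> m; rewrite mem_filter addSnnS => /andP[_ /sM].
Qed.

Lemma cvg_sum_nz_ball (R : realType) (B : R) (x : int -> R) : 0 <= B ->
  (forall m : int, m != 0 -> `|x m| <= B * 2^-1 ^+ `|m|%N) ->
  cvgn (fun N => \sum_(m <- nz_ball N) x m).
Proof.
move=> B0 xB; rewrite sum_nz_ball; apply: normed_cvg.
apply: (@series_le_cvg _ _ (geometric B 2^-1)) => //=.
- by move=> n; rewrite mulr_ge0// exprn_ge0 ?invr_ge0.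
- move=> n; apply: le_trans (ler_normD _ _) _.
  have -> : B * 2^-1 ^+ n = B * 2^-1 ^+ n.+1 + B * 2^-1 ^+ n.+1.
    by rewrite exprS; field.
  by apply: lerD; apply: xB.
- apply: is_cvg_geometric_series.
  by rewrite ger0_norm ?invr_ge0// invf_lt1// ltr1n.
Qed.

(** The remainder is uniform over all finite index sets that contain the ball of
    radius [N], which is what unconditional convergence requires: such a set
    [s] lies in some larger ball, and the difference of the two sums only
    involves indices of modulus greater than [N]. *)
Lemma sum_nz_ball_remainder (R : realType) (B : R) (x : int -> R)
    (N : nat) (s : seq int) : 0 <= B ->
  (forall m : int, m != 0 -> `|x m| <= B * 2^-1 ^+ `|m|%N) ->
  uniq s -> 0 \notin s -> {subset nz_ball N <= s} ->
  `|\sum_(m <- s) x m - limn (fun N => \sum_(m <- nz_ball N) x m)|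
    <= B * (2 * 2^-1 ^+ N).
Proof.
move=> B0 xB us s0 Ns.
have cv : `|\sum_(m <- s) x m - \sum_(m <- nz_ball M) x m| @[M --> \oo] -->
    `|\sum_(m <- s) x m - limn (fun M => \sum_(m <- nz_ball M) x m)|.
  apply: cvg_norm; apply: cvgB; first exact: cvg_cst.
  exact: cvg_sum_nz_ball B0 xB.
rewrite -(cvg_lim (@Rhausdorff R) cv); apply: limr_le.
  by apply/cvg_ex; eexists; exact: cv.
exists (\max_(m <- s) `|m|%N) => // M /= sM.
have sub : {subset s <= nz_ball M}.
  move=> m ms; rewrite mem_nz_ball absz_gt0; apply/andP; split.
    by apply: contraNneq s0 => <-.
  by apply: leq_trans sM; apply: leq_bigmax_seq.
rewrite [X in _ - X](bigID (fun m => m \in s)) /= -[X in _ - (X + _)]big_filter.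
rewrite [X in _ - (X + _)](perm_big s); last first.
  apply: uniq_perm => //; first exact: filter_uniq (nz_ball_uniq M).
  by move=> m; rewrite mem_filter andb_idr//; exact: sub.
rewrite opprD addrA subrr add0r normrN -big_filter.
apply: le_trans (ler_norm_sum _ _ _) _.
set r := [seq m <- nz_ball M | m \notin s].
have rP m : m \in r -> [/\ m \notin s, m != 0 & (N < `|m|)%N].
  rewrite mem_filter mem_nz_ball => /and3P[ms m0 _].
  split => //; first by rewrite -absz_gt0.
  by rewrite ltnNge; apply: contra ms => mN; apply: Ns; rewrite mem_nz_ball m0.
apply: (@le_trans _ _ (\sum_(m <- r) B * 2^-1 ^+ `|m|%N)).
  by rewrite !big_seq; apply: ler_sum => m /rP[_ m0 _]; exact: xB.
rewrite -mulr_sumr ler_wpM2l// sum_half_pow_tail ?filter_uniq ?nz_ball_uniq//.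
by apply/allP => m /rP[].
Qed.

(** Real and imaginary parts are summed separately. Measurability of the sum
    comes from pointwise convergence of the ball sums; the norm bound is the
    remainder estimate for the empty index set and radius 0, where each part is
    at most [2 B]: hence the factor [8 = 2 * 2^2]. *)
Lemma L2_has_sum_dyadic (R : realType) (a b B : R) (f : int -> R -> R[i]) :
  a < b -> 0 <= B ->
  (forall m, measurable_fun `]a, b[ (fun t => complex.Re (f m t))) ->
  (forall m, measurable_fun `]a, b[ (fun t => complex.Im (f m t))) ->
  (forall (m : int) t, m != 0 ->
     ComplexField.Normc.normc (f m t) <= B * 2^-1 ^+ `|m|%N) ->
  exists g, L2_has_sum `]a, b[ Zstar f g /\
    (L2sqnorm `]a, b[ g <= (8 * B ^+ 2 * (b - a))%:E)%E.
Proof.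
move=> ab B0 mr mi fB.
have rB t (m : int) m0 := (normr_Re_Im_le (fB m t m0)).1.
have iB t (m : int) m0 := (normr_Re_Im_le (fB m t m0)).2.
pose u N t := \sum_(m <- nz_ball N) complex.Re (f m t).
pose v N t := \sum_(m <- nz_ball N) complex.Im (f m t).
pose g t := limn (u^~ t) +i* limn (v^~ t).
have mg1 : measurable_fun `]a, b[ (fun t => complex.Re (g t)).
  apply: (@measurable_fun_cvg _ _ _ _ u).
    by move=> N; apply: measurable_sum.
  by move=> t _; exact: cvg_sum_nz_ball B0 (rB t).
have mg2 : measurable_fun `]a, b[ (fun t => complex.Im (g t)).
  apply: (@measurable_fun_cvg _ _ _ _ v).
    by move=> N; apply: measurable_sum.
  by move=> t _; exact: cvg_sum_nz_ball B0 (iB t).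
have rem N (s : seq int) : uniq s -> 0 \notin s -> {subset nz_ball N <= s} ->
    (L2sqnorm `]a, b[ (fun t => (\sum_(m <- s) f m t - g t)%R) <=
     (8 * B ^+ 2 * (b - a) * 4^-1 ^+ N)%:E)%E.
  move=> us s0 Ns.
  have -> : 8 * B ^+ 2 * (b - a) * 4^-1 ^+ N =
      2 * (B * (2 * 2^-1 ^+ N)) ^+ 2 * (b - a).
    have -> : 4^-1 = 2^-1 ^+ 2 :> R by field.
    by rewrite -exprM mulnC exprM; ring.
  apply: L2sqnorm_le_bounded => //.
  - rewrite [X in measurable_fun _ X](_ : _ =
      (fun t => \sum_(m <- s) complex.Re (f m t)) \-
        (fun t => complex.Re (g t))).
      by apply: measurable_funB => //; exact: measurable_sum.
    by apply/funext => t; rewrite /= -Re_sum; case: (\sum_(_ <- _) _).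
  - rewrite [X in measurable_fun _ X](_ : _ =
      (fun t => \sum_(m <- s) complex.Im (f m t)) \-
        (fun t => complex.Im (g t))).
      by apply: measurable_funB => //; exact: measurable_sum.
    by apply/funext => t; rewrite /= -Im_sum; case: (\sum_(_ <- _) _).
  - move=> t; have := sum_nz_ball_remainder B0 (rB t) us s0 Ns.
    by rewrite -Re_sum; case: (\sum_(_ <- _) _).
  - move=> t; have := sum_nz_ball_remainder B0 (iB t) us s0 Ns.
    by rewrite -Im_sum; case: (\sum_(_ <- _) _).
have g0 : (L2sqnorm `]a, b[ g <= (8 * B ^+ 2 * (b - a))%:E)%E.
  have := rem 0%N [::] isT isT (fun _ => id).
  rewrite expr0 mulr1; congr (_ <= _)%E; apply: eq_integral => t _.
  by rewrite big_nil sub0r !sqr_normc /= !sqrrN.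
exists g; split => //; split.
  by split => //; exact: le_lt_trans g0 (ltry _).
move=> eps eps0.
have z4 : `|4^-1 : R| < 1 by rewrite ger0_norm ?invr_ge0// invf_lt1// ltr1n.
have [N _ hN] := cvgr_lt 0 (cvg_geometric (8 * B ^+ 2 * (b - a)) z4) eps eps0.
have N0E := seq_fsetE tt (nz_ball N).
exists (seq_fset tt (nz_ball N)) => [m mN|F NF FS].
  have : m \in nz_ball N by rewrite -N0E.
  by rewrite mem_nz_ball absz_gt0 => /andP[].
apply: le_lt_trans (rem N F (fset_uniq F) _ _) _.
- by apply/negP => /FS /negP; apply.
- by move=> m; rewrite -N0E; exact: NF.
- by rewrite lte_fin; apply: (hN N) => /=.
Qed.

(** * Coefficients with finite weighted sum *)

(** A single term of the weighted sum is at most the whole sum, and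
    [e^{m^6} >= e^{|m|} >= 2^{|m|}].  The factor 1 in the exponent stands for the
    constant [b]. *)
Lemma coeff_dyadic_bound (R : realType) (c : int -> R[i]) :
  (\esum_(m in Zstar) (ComplexField.Normc.normc (c m) ^+ 2
     * expR (2 * 1 * m%:~R ^+ 6))%R%:E < +oo)%E ->
  exists A : R, [/\ 0 <= A,
   \esum_(m in Zstar) (ComplexField.Normc.normc (c m) ^+ 2
     * expR (2 * 1 * m%:~R ^+ 6))%R%:E = A%:E &
   forall m, m != 0 -> Normc.normc (c m) <= Num.sqrt A * 2^-1 ^+ `|m|%N].
Proof.
pose w (m : int) : \bar R :=
  (Normc.normc (c m) ^+ 2 * expR (2 * 1 * m%:~R ^+ 6))%:E.
rewrite -[X in (X < _)%E]/(\esum_(m in Zstar) w m).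
rewrite -[esum _ _]/(\esum_(m in Zstar) w m).
set E := esum _ _ => fin.
have w0 m : (0 <= w m)%E by rewrite lee_fin mulr_ge0 ?sqr_ge0 ?expR_ge0.
have E0 : (0 <= E)%E by apply: esum_ge0.
have [A EA] : exists A, E = A%:E.
  by exists (fine E); rewrite fineK// ge0_fin_numE.
have A0 : 0 <= A by rewrite -lee_fin -EA.
exists A; split => //.
move=> m m0.
have wE : (w m <= E)%E.
  apply: esum_ge; exists [set m]; last by rewrite fsbig_set1.
  by split => // _ ->.
move: wE; rewrite EA lee_fin /w => wE.
rewrite exprVn ler_pdivlMr ?exprn_gt0//.
have c0 : 0 <= Normc.normc (c m) by case: (c m) => ? ?; exact: sqrtr_ge0.
rewrite -(@ler_pXn2r _ 2) ?nnegrE ?mulr_ge0 ?exprn_ge0 ?sqrtr_ge0//.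
rewrite sqr_sqrtr// exprMn; apply: le_trans wE.
rewrite ler_wpM2l ?sqr_ge0// mulr1 expRM_natl.
rewrite lerXn2r ?nnegrE ?exprn_ge0 ?expR_ge0//.
have e2 : 2 <= expR 1 :> R by have := expR_ge1Dx (1 : R); lra.
apply: (@le_trans _ _ (expR 1 ^+ `|m|%N)); first by rewrite lerXn2r ?nnegrE.
rewrite -expRM_natl mulr1 ler_expR.
have -> : m%:~R ^+ 6 = (`|m| ^ 6)%N%:R :> R.
  by rewrite natrX natr_absz intr_norm -normrX ger0_norm ?exprn_even_ge0.
by rewrite ler_nat; rewrite -[X in (X <= _)%N]expn1 leq_pexp2l// absz_gt0.
Qed.

(** * The biorthogonal family *)

Theorem theorem2p4 (R : realType) :
  exists T b C : R, [/\ 2 * pi < T, 0 < b & 0 < C] /\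
  let I : set R := (`]- (T / 2), (T / 2)[%classic) in
  exists zeta : int -> R -> R[i],
    biorthogonal I zeta (fun m t => cexp (- lambda R m * (t%:C)%C)) /\
    forall c : int -> R[i],
      let rhs := (C%:E * \esum_(m in Zstar)
        (ComplexField.Normc.normc (c m) ^+ 2
           * expR (2 * b * m%:~R ^+ 6))%R%:E)%E in
      (rhs < +oo)%E ->
      exists g : R -> R[i],
        L2_has_sum I Zstar (fun m t => c m * zeta m t) g /\
        (L2sqnorm I g <= rhs)%E.
Proof.
have pi0 := pi_gt0 R.
have ab : - (2 * pi) < 2 * pi :> R by lra.
exists (4 * pi), 1, (2 / pi); split; first by split; rewrite ?divr_gt0//; lra.
have -> : 4 * pi / 2 = 2 * pi :> R by field.
move=> I.
pose e (m : int) (t : R) : R[i] :=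
  cos ((freq m)%:~R * t) +i* sin ((freq m)%:~R * t).
have -> : (fun m t => cexp (- lambda R m * (t%:C)%C)) = e.
  by apply/funext => m; apply/funext => t; exact: cexp_lambda.
have normce m t : Normc.normc (e m t) = 1 by rewrite /= cos2Dsin2 sqrtr1.
have mcos m : measurable_fun I (fun t => cos ((freq m)%:~R * t)).
  apply: measurable_funTS; apply: continuous_measurable_fun.
  exact: continuous_comp_scale (@continuous_cos R).
have msin m : measurable_fun I (fun t => sin ((freq m)%:~R * t)).
  apply: measurable_funTS; apply: continuous_measurable_fun.
  exact: continuous_comp_scale (@continuous_sin R).
have mre (a : R[i]) m : measurable_fun I (fun t => complex.Re (a * e m t)).
  case: a => x y /=; apply: measurable_funB; exact: measurable_funM.
have mim (a : R[i]) m : measurable_fun I (fun t => complex.Im (a * e m t)).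
  case: a => x y /=; apply: measurable_funD; exact: measurable_funM.
have L2e (a : R[i]) m : inL2 I (fun t => a * e m t).
  have bd t := normr_Re_Im_le (lexx (Normc.normc (a * e m t))).
  apply: (@inL2_bounded _ _ _ (Normc.normc a)) => // t.
    by have := (bd t).1; rewrite Normc.normcM normce mulr1.
  by have := (bd t).2; rewrite Normc.normcM normce mulr1.
exists (fun m t => ((4 * pi)^-1)%:C * e m t); split.
  split => [m|n|m n]; first exact: L2e.
    by have := L2e 1 n; congr inL2; apply/funext => t; rewrite mul1r.
  rewrite -[m == n](inj_eq freq_inj) -subr_eq0 -cintegral_cexp_int.
  congr cintegral; apply/funext => t.
  by rewrite -mulrA cos_sin_conj -intrB.
move=> c rhs fin.
have [|A [A0 EA cA]] := @coeff_dyadic_bound R c.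
  rewrite ltNge leye_eq; apply: contraTN fin => /eqP E.
  by rewrite /rhs E gt0_muley ?ltxx// lte_fin divr_gt0.
have p4 : 0 < (4 * pi)^-1 :> R by rewrite invr_gt0; lra.
have [|m|m|m t m0|g [sg gB]] := @L2_has_sum_dyadic R _ _ (Num.sqrt A / (4 * pi))
    (fun m t => c m * (((4 * pi)^-1)%:C * e m t)) ab.
- by rewrite divr_ge0 ?sqrtr_ge0//; lra.
- have := mre (c m * ((4 * pi)^-1)%:C) m; congr measurable_fun.
  by apply/funext => t; rewrite mulrA.
- have := mim (c m * ((4 * pi)^-1)%:C) m; congr measurable_fun.
  by apply/funext => t; rewrite mulrA.
- rewrite !Normc.normcM normce mulr1 /= expr0n addr0 sqrtr_sqr gtr0_norm//.
  by rewrite mulrAC ler_wpM2r ?cA// ltW.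
exists g; split => //; apply: le_trans gB _.
rewrite /rhs EA lee_fin exprMn sqr_sqrtr//.
rewrite le_eqVlt; apply/orP; left; apply/eqP; field; lra.
Qed.
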